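(* Let $S\subset\mathbb{R}^n$ be a surface with band $B(S)$ (as in the context), and let $r:B(S)\to S$ be a $C^1$-retraction. Then $Dr(y)=P(y)$ for all $y\in S$ (that is, $r$ is a closest point function) if and only if for every $y\in S$ the pre-image $r^{-1}(y)$, which is a $C^1$-manifold locally around $y$, intersects $S$ orthogonally at $y$, i.e. $$\mathcal{T}_y\, r^{-1}(y)=\mathcal{N}_yS .$$
   Context: Surfaces. $S$ is an embedded $C^2$-submanifold of $\mathbb{R}^n$ without boundary (if there is a boundary, $S$ is identified with its interior), of dimension $k\le n$, possessing a tubular neighborhood $B(S)\subset\mathbb{R}^n$, an open set containing $S$, called a band around $S$. $S$ is orientable in the sense that, if $k<n$, there are smooth unit vector fields $N_1,\dots,N_{n-k}:S\to\mathbb{R}^n$ spanning the normal space $\mathcal{N}_yS$ at each $y\in S$. $\mathcal{T}_yS$ is the tangent space, $\mathcal{N}_yS$ its orthogonal complement in $\mathbb{R}^n$, and $P(y)\in\mathbb{R}^{n\times n}$ is the orthogonal projector of $\mathbb{R}^n$ onto $\mathcal{T}_yS$. $C^1$-retraction. A map $r:B(S)\to S$ that is continuously differentiable (as a map into $\mathbb{R}^n$) with $r(y)=y$ for all $y\in S$. A closest point function is a $C^1$-retraction $r:B(S)\to S$ with $Dr(y)=P(y)$ for all $y\in S$. For a $C^1$-retraction $r$ and $y\in S$, there is a neighborhood of $y$ in $\mathbb{R}^n$ in which $r^{-1}(y)=\{x\in B(S): r(x)=y\}$ is an embedded $C^1$-submanifold of $\mathbb{R}^n$; $\mathcal{T}_y\,r^{-1}(y)$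 denotes its tangent space at $y$. *)

(* Defs.v *)
From HB Require Import structures.
From mathcomp Require Export all_boot all_order all_algebra.
From mathcomp Require Export all_classical all_reals all_analysis.
Export Order.TTheory GRing.Theory Num.Theory.
Export numFieldNormedType.Exports.

Set Implicit Arguments.
Unset Strict Implicit.
Unset Printing Implicit Defensive.

Local Open Scope classical_set_scope.
Local Open Scope ring_scope.

(* f is of class C^j on the open set U.  Only used between finite-dimensional
   spaces, where continuity (resp. C^j regularity) of x |-> Df(x) in operator
   norm amounts to that of x |-> Df(x) v for every fixed v. *)
Fixpoint class_C {R : realType} {V W : normedModType R} (j : nat) (U : set V)
    (f : V -> W) : Prop :=
  match j with
  | 0 => forall x, U x -> {for x, continuous f}
  | j'.+1 => (forall x, U x -> differentiable f x) /\
             (forall v : V, class_C j' U (fun x => 'd f x v))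
  end.

(* C^1 on an arbitrary subset A: f has local C^1 extensions to open sets. *)
Definition C1_on_subset {R : realType} {V W : normedModType R} (A : set V)
    (f : V -> W) : Prop :=
  forall a, A a -> exists (U : set V) (g : V -> W),
    [/\ open U, U a, class_C 1 U g & forall x, A x -> U x -> g x = f x].

Section Euclidean.
Context {R : realType} {n : nat}.
Implicit Types (S B M T U V : set 'rV[R]_n) (y : 'rV[R]_n).

Definition dotp (u v : 'rV[R]_n) : R := \sum_(i < n) u 0 i * v 0 i.

Definition orth_compl T : set 'rV[R]_n :=
  [set v | forall w, T w -> dotp v w = 0].

(* phi : U -> V is a C^j diffeomorphism between open sets with inverse psi. *)
Definition diffeo (j : nat) U V (phi psi : 'rV[R]_n -> 'rV[R]_n) : Prop :=
  [/\ open U /\ open V,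
      class_C j U phi /\ class_C j V psi,
      forall x, U x -> V (phi x) /\ psi (phi x) = x &
      forall z, V z -> U (psi z) /\ phi (psi z) = z].

(* Slice charts: phi maps M `&` U onto the part of V in R^k x {0}.  The slice
   is not a half-space, so M has no boundary. *)
Definition embedded_submanifold (j k : nat) M : Prop :=
  (k <= n)%N /\
  forall y, M y -> exists U V (phi psi : 'rV[R]_n -> 'rV[R]_n),
    [/\ U y, diffeo j U V phi psi &
        forall x, U x -> (M x <-> forall i : 'I_n, (k <= i)%N -> phi x 0 i = 0)].

(* Velocities at y of C^1 curves that run in M. *)
Definition tangent_space M y : set 'rV[R]_n :=
  [set v | exists (e : R) (c : R -> 'rV[R]_n),
    [/\ 0 < e,
        class_C 1 `]- e, e[%classic c,
        forall t, - e < t < e -> M (c t),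
        c 0 = y &
        derive1 c 0 = v]].

Definition normal_space M y : set 'rV[R]_n := orth_compl (tangent_space M y).

Definition normal_bundle M : set ('rV[R]_n * 'rV[R]_n) :=
  [set p | M p.1 /\ normal_space M p.1 p.2].

(* Vectors are rows, so a matrix Q acts by v |-> v *m Q, as does the
   Jacobian 'J f y; an orthogonal projector is symmetric. *)
Definition is_orth_projector T (Q : 'M[R]_n) : Prop :=
  forall v : 'rV[R]_n, T (v *m Q) /\ orth_compl T (v - v *m Q).

(* The orthogonal projector onto T exists and is unique as soon as T is a
   linear subspace; 0 is a dummy value for other T. *)
Definition orth_projector T : 'M[R]_n := xget 0 [set Q | is_orth_projector T Q].

(* The normal bundle of a C^2 surface is of class C^1, hence so are the
   normal fields. *)
Definition orientable (k : nat) S : Prop :=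
  (k < n)%N -> exists N : 'I_(n - k) -> 'rV[R]_n -> 'rV[R]_n,
    (forall i, C1_on_subset S (N i)) /\
    forall y, S y ->
      (forall i, dotp (N i y) (N i y) = 1) /\
      (forall v, normal_space S y v <->
         exists a : 'I_(n - k) -> R, v = \sum_(i < n - k) a i *: N i y).

(* B is open and C^1-diffeomorphic to the normal bundle of S, the zero section
   corresponding to S. *)
Definition tubular_neighborhood S B : Prop :=
  [/\ open B, S `<=` B &
      exists (F : 'rV[R]_n * 'rV[R]_n -> 'rV[R]_n)
             (G : 'rV[R]_n -> 'rV[R]_n * 'rV[R]_n),
      [/\ C1_on_subset (normal_bundle S) F /\ class_C 1 B G,
          forall p, normal_bundle S p -> B (F p) /\ G (F p) = p,
          forall x, B x -> normal_bundle S (G x) /\ F (G x) = x &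
          forall y, S y -> F (y, 0) = y]].

Definition surface_with_band (k : nat) S B : Prop :=
  [/\ embedded_submanifold 2 k S, orientable k S & tubular_neighborhood S B].

Definition C1_retraction S B (r : 'rV[R]_n -> 'rV[R]_n) : Prop :=
  [/\ class_C 1 B r, forall x, B x -> S (r x) & forall y, S y -> r y = y].

Definition preimage_in B (r : 'rV[R]_n -> 'rV[R]_n) y : set 'rV[R]_n :=
  [set x | B x /\ r x = y].

Definition locally_C1_manifold M y : Prop :=
  exists (W : set 'rV[R]_n) (d : nat),
    [/\ open W, W y & embedded_submanifold 1 d (M `&` W)].

End Euclidean.

(* Main.v *)
From HB Require Import structures.
From mathcomp Require Import ring lra zify.
Require Import Defs.
Local Open Scope classical_set_scope.
Local Open Scope ring_scope.
Set Implicit Arguments.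
Unset Strict Implicit.
Unset Printing Implicit Defensive.

(** Write [D] for the differential of the retraction [r] at [y], [T] for the
    tangent space of [S] at [y] and [phi] for a slice chart of [S] around [y].
    As [r] maps into [S] and fixes [S], [D] maps into [T] and is the identity
    on [T], so it is a projector onto [T].  The coordinates of [phi (r x)] along
    [S], completed by the coordinates of [x] transversal to [S] at [y], have
    an invertible differential at [y]; by the inverse function theorem they form
    a slice chart of the fiber of [r] over [y], whose tangent space is therefore
    the kernel of [D].  A projector onto [T] is the orthogonal one exactly when
    its kernel is the orthogonal complement of [T]. *)

(** * Differential calculus *)

Section calculus.
Context {R : realType}.
Implicit Types V W : normedModType R.

Lemma diff_near_bound V W (f : V -> W) (x : V) : differentiable f x ->
  forall e : R, 0 < e -> \forall h \near (0 : V),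
    `|f (h + x) - f x - 'd f x h| <= e * `|h|.
Proof.
move=> /diff_locally /eqaddoP fx e e0.
near=> h.
have : `|((f \o shift x) - (cst (f x) + 'd f x)) h| <= e * `|h|.
  by near: h; apply: fx.
by rewrite !fctE /= opprD addrA.
Unshelve. all: by end_near. Qed.

(** Turns an epsilon estimate for a guessed linear map into a differential; the local inverse is
    differentiated this way. *)
Lemma is_diff_near_bound V W (f : V -> W) (x : V) (L : {linear V -> W}) :
  continuous L ->
  (forall e : R, 0 < e -> \forall h \near (0 : V),
    `|f (h + x) - f x - L h| <= e * `|h|) ->
  is_diff x f L.
Proof.
move=> Lc fL.
have fE : f \o shift x = cst (f x) + L +o_ 0 id.
  apply/eqaddoP => e e0; near=> h; rewrite !fctE /= opprD addrA.
  by near: h; apply: fL.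
have dE : 'd f x = L :> (V -> W) by exact: diff_unique.
by apply: DiffDef => //; apply/diff_locallyP; rewrite dE.
Unshelve. all: by end_near. Qed.

Lemma near_eq_continuous (T U : topologicalType) (f g : T -> U) (x : T) :
  (\forall y \near x, f y = g y) -> {for x, continuous f} ->
  {for x, continuous g}.
Proof.
move=> fg; rewrite /prop_for /continuous_at.
by rewrite -(nbhs_singleton fg); apply: cvg_trans; apply: near_eq_cvg.
Qed.

Lemma sum_continuous (T : topologicalType) W n (f : 'I_n -> T -> W) (x : T) :
  (forall i, {for x, continuous (f i)}) ->
  {for x, continuous (fun y => \sum_(i < n) f i y)}.
Proof.
elim: n f => [|n IH] f fc.
  rewrite (_ : (fun _ => _) = cst 0); first exact: cst_continuous.
  by apply/funext => y; rewrite big_ord0.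
rewrite (_ : (fun _ => _) =
    (fun y => f ord0 y + \sum_(i < n) f (lift ord0 i) y)).
  by apply: cvgD; [exact: fc|apply: IH => i; exact: fc].
by apply/funext => y; rewrite big_ord_recl.
Qed.

(** * Linear maps out of spaces of row vectors *)

Lemma linear_rV_sum n W (L : {linear 'rV[R]_n -> W}) v :
  L v = \sum_(i < n) v 0 i *: L (delta_mx 0 i).
Proof.
rewrite {1}(row_sum_delta v) linear_sum.
by apply: eq_bigr => i _; rewrite linearZ.
Qed.

(** Expansion in the standard basis reduces joint continuity to finitely many fixed vectors. The
    chain rule needs this, since [class_C] controls ['d f x v] only for fixed [v]. *)
Lemma continuous_linear_rV n (T : topologicalType) W
    (L : T -> {linear 'rV[R]_n -> W}) (w : T -> 'rV[R]_n) (x : T) :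
  (forall v, {for x, continuous (fun y => L y v)}) -> {for x, continuous w} ->
  {for x, continuous (fun y => L y (w y))}.
Proof.
move=> Lc wc.
rewrite (_ : (fun _ => _) =
    (fun y => \sum_(i < n) w y 0 i *: L y (delta_mx 0 i))); last first.
  by apply/funext => y; rewrite linear_rV_sum.
apply: sum_continuous => i; apply: cvgZ; last exact: Lc.
exact: (continuous_comp wc (@coord_continuous _ _ _ 0 i (w x))).
Qed.

Lemma linear_rV_continuous n W (L : {linear 'rV[R]_n -> W}) : continuous L.
Proof.
move=> x; apply: (continuous_linear_rV (L := fun=> L) (w := id)) => [v|].
  exact: cst_continuous.
by [].
Qed.

Lemma norm_rV_coord n (v : 'rV[R]_n) i : `|v 0 i| <= `|v|.
Proof.
rewrite [leRHS]/Num.norm /= mx_normrE.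
by apply/bigmax_geP; right; exists (0, i).
Qed.

Lemma norm_rV_le n (v : 'rV[R]_n) c :
  0 <= c -> (forall i, `|v 0 i| <= c) -> `|v| <= c.
Proof.
move=> c0 vc; rewrite [leLHS]/Num.norm /= mx_normrE.
by apply/bigmax_leP; split => // -[i j] _ /=; rewrite (ord1 i).
Qed.

Lemma norm_linear_rV_le n W (L : {linear 'rV[R]_n -> W}) (c : R) :
  (forall i, `|L (delta_mx 0 i)| <= c) -> forall v, `|L v| <= n%:R * c * `|v|.
Proof.
move=> Lc v; rewrite linear_rV_sum (le_trans (ler_norm_sum _ _ _))//.
have -> : n%:R * c * `|v| = \sum_(i < n) `|v| * c.
  by rewrite sumr_const card_ord -[RHS]mulr_natl -mulrA (mulrC c).
by apply: ler_sum => i _; rewrite normrZ ler_pM// norm_rV_coord.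
Qed.

(** * Maps of class C^1 *)

Lemma class_CSW V W j (U : set V) (f : V -> W) :
  class_C j.+1 U f -> class_C j U f.
Proof.
elim: j f => [|j IH] f [df cf]; first by move=> x /df/differentiable_continuous.
by split => // v; apply/IH/cf.
Qed.

Lemma class_C_sub V W j (U U' : set V) (f : V -> W) :
  U' `<=` U -> class_C j U f -> class_C j U' f.
Proof.
move=> sU; elim: j f => [|j IH] f /=; first by move=> cf x /sU; exact: cf.
by move=> [df cf]; split => [x /sU/df//|v]; exact/IH/cf.
Qed.

Lemma class_C1_comp V W n (U : set V) (U' : set 'rV[R]_n)
    (f : V -> 'rV[R]_n) (g : 'rV[R]_n -> W) :
  open U -> class_C 1 U f -> class_C 1 U' g -> (forall x, U x -> U' (f x)) ->
  class_C 1 U (g \o f).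
Proof.
move=> oU [df cf] [dg cg] fU; split => [x Ux|v x Ux].
  by apply: differentiable_comp; [exact: df|exact/dg/fU].
apply: (@near_eq_continuous _ _ (fun z => 'd g (f z) ('d f z v))).
  near=> z; have Uz : U z by near: z; exact: open_nbhs_nbhs.
  by rewrite (diff_comp (df _ Uz) (dg _ (fU _ Uz))).
apply: continuous_linear_rV => [w|]; last exact: cf.
have fc := differentiable_continuous (df _ Ux).
exact: (continuous_comp fc (cg w _ (fU _ Ux))).
Unshelve. all: by end_near. Qed.

Lemma class_C1_is_diff V W (U : set V) (f : V -> W) (df : V -> V -> W) :
  open U -> (forall x, U x -> is_diff x f (df x)) ->
  (forall v x, U x -> {for x, continuous (df ^~ v)}) -> class_C 1 U f.
Proof.
move=> oU dfE dfc; split => [x /dfE []//|v x Ux].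
apply: (@near_eq_continuous _ _ (df ^~ v)); last exact: dfc.
near=> z; have Uz : U z by near: z; exact: open_nbhs_nbhs.
by have [_ ->] := dfE _ Uz.
Unshelve. all: by end_near. Qed.

Lemma class_C1D V W (U : set V) (f g : V -> W) :
  open U -> class_C 1 U f -> class_C 1 U g -> class_C 1 U (f + g).
Proof.
move=> oU [df cf] [dg cg].
apply: (@class_C1_is_diff _ _ _ _ (fun x => 'd f x \+ 'd g x)) => //.
  move=> x Ux; have /differentiableP ? := df _ Ux.
  have /differentiableP ? := dg _ Ux; exact: is_diffD.
by move=> v x Ux; apply: cvgD; [exact: cf|exact: cg].
Qed.

Lemma is_diff_linear_rV n W (L : {linear 'rV[R]_n -> W}) x : is_diff x L L.
Proof.
have Lc := @linear_rV_continuous _ _ L.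
by apply: DiffDef; [exact: linear_differentiable|exact: diff_lin].
Qed.

Lemma class_C1_linear_rV n W (U : set 'rV[R]_n) (L : {linear 'rV[R]_n -> W}) :
  class_C 1 U L.
Proof.
have Lc := @linear_rV_continuous _ _ L.
split => [x _|v x _]; first exact: linear_differentiable.
rewrite (_ : (fun _ => _) = cst (L v)); first exact: cst_continuous.
by apply/funext => z; rewrite diff_lin.
Qed.

Lemma class_C1_cst V W (U : set V) (a : W) : class_C 1 U (cst a).
Proof.
split => [x _|v x _]; first exact: differentiable_cst.
rewrite (_ : (fun _ => _) = cst 0); first exact: cst_continuous.
by apply/funext => z; rewrite diff_cst.
Qed.

Lemma is_diff_affine V (a w : V) (t : R) :
  is_diff t (fun t : R => t *: w + a) ( *:%R ^~ w).
Proof.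
have -> : (fun t : R => t *: w + a) = ( *:%R ^~ w) + cst a by [].
by apply: is_diff_eq; rewrite addr0.
Qed.

Lemma class_C1_affine V (U : set R) (a w : V) :
  class_C 1 U (fun t : R => t *: w + a).
Proof.
split => [t _|v t _]; first by case: (is_diff_affine a w t).
rewrite (_ : (fun _ => _) = cst (v *: w)); first exact: cst_continuous.
by apply/funext => s; have [_ ->] := is_diff_affine a w s.
Qed.

End calculus.

(** * Inverse function theorem *)

(* Makes ['M[R]_(m, n)] a [completeNormedModType], which the instances of
   [Complete] and [NormedModule] alone do not give. *)
HB.instance Definition _ (R : realType) m n :=
  Uniform_isComplete.Build 'M[R]_(m, n) (@mx_complete R m n).

Section inverse_function.
Context {R : realType}.

Lemma is_diff_coord m n (M : 'M[R]_(m, n)) i j :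
  is_diff M (fun N : 'M[R]_(m, n) => N i j : R) (fun N => N i j).
Proof.
have @f : {linear 'M[R]_(m, n) -> R}.
  by exists (fun N : 'M[R]_(_, _) => N i j); do 2![eexists]; do ?[constructor];
     rewrite ?mxE// => ? *; rewrite ?mxE//; move=> ?; rewrite !mxE.
have fc : continuous f by exact: coord_continuous.
suff : is_diff M f f by [].
by apply: DiffDef; [exact: linear_differentiable|rewrite diff_lin].
Qed.

Lemma open_setI_preimage (T U : topologicalType) (f : T -> U) (A : set T)
    (B : set U) :
  open A -> open B -> (forall x, A x -> {for x, continuous f}) ->
  open (A `&` f @^-1` B).
Proof.
move=> oA oB fc; rewrite openE => x [Ax Bx]; apply: filterI.
  exact: open_nbhs_nbhs.
by apply: fc => //; exact: open_nbhs_nbhs.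
Qed.

(** In the maximum norm it suffices to bound each coordinate, by the one-variable mean value theorem
    along the segment from [a] to [b]; the second hypothesis is convexity of [A]. *)
Lemma mean_value_bound (V : normedModType R) n (f : V -> 'rV[R]_n) (A : set V)
    (c : R) :
  0 <= c ->
  (forall a b (t : R), A a -> A b -> 0 <= t <= 1 -> A (t *: (b - a) + a)) ->
  (forall x, A x -> differentiable f x) ->
  (forall x v, A x -> `|'d f x v| <= c * `|v|) ->
  forall a b, A a -> A b -> `|f b - f a| <= c * `|b - a|.
Proof.
move=> c0 Acvx df fc a b Aa Ab; apply: norm_rV_le => [|i].
  by rewrite mulr_ge0.
pose p (t : R) := t *: (b - a) + a.
pose g (t : R) := f (p t) 0 i.
have dg (t : R) : 0 <= t <= 1 -> is_derive t 1 g ('d f (p t) (b - a) 0 i).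
  move=> t01.
  have dp : is_diff t p ( *:%R ^~ (b - a)) by exact: is_diff_affine.
  have dfp : is_diff (p t) f ('d f (p t)).
    by apply/differentiableP/df; exact: Acvx.
  have dgt : is_diff t g (fun s => 'd f (p t) (s *: (b - a)) 0 i).
    have dfpt : is_diff t (f \o p) ('d f (p t) \o *:%R ^~ (b - a)).
      exact: is_diff_comp.
    have := is_diff_coord (f (p t)) 0 i.
    by move=> /(is_diff_comp dfpt).
  have [dgd dge] := dgt; apply: DeriveDef; first exact: diff_derivable.
  by rewrite deriveE// dge scale1r.
have [||s s01] := @MVT_segment R g (fun t => 'd f (p t) (b - a) 0 i) 0 1 ler01.
- move=> x; rewrite in_itv /= => /andP[x0 x1]; apply: dg.
  by rewrite !ltW.
- apply: derivable_within_continuous => x; rewrite in_itv /= => x01.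
  by have [] := dg _ x01.
rewrite subr0 mulr1 /g /p scale1r subrK scale0r add0r => gE.
rewrite !mxE gE (le_trans (norm_rV_coord _ _))// fc//.
by apply: Acvx => //; move: s01; rewrite in_itv.
Qed.

(* Since [id - f] has small differential near [y], it is a contraction there;
   the equation [f x = z] is the fixed point equation [x = z + (x - f x)]. *)
Lemma local_inverse_id n (f : 'rV[R]_n -> 'rV[R]_n) (U : set 'rV[R]_n) y :
  open U -> U y -> class_C 1 U f -> (forall v, 'd f y v = v) ->
  exists U' V' : set 'rV[R]_n,
  [/\ open U' /\ open V', U' y /\ U' `<=` U,
      forall x v, U' x -> `|v| <= 2 * `|'d f x v|,
      forall a b, U' a -> U' b -> `|b - a| <= 2 * `|f b - f a| &
      forall x, U' x -> V' (f x)] /\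
  forall z, V' z -> exists2 x, U' x & f x = z.
Proof.
move=> oU Uy [df cf] dfy.
(* A bound [c] on the basis vectors bounds the operator norm by [n * c <= 1/2]; the successor keeps
   [c] positive when [n = 0]. *)
pose c : R := (2 * n.+1%:R)^-1.
have c0 : 0 < c by rewrite invr_gt0 mulr_gt0.
have nc : n%:R * c <= 2^-1.
  rewrite /c invfM mulrCA ger_pMr// ler_pdivrMr// mul1r ler_nat//.
have [e /= e0 eU] : exists2 e : R, 0 < e & forall x, ball y e x ->
    U x /\ forall i : 'I_n, `|delta_mx 0 i - 'd f x (delta_mx 0 i)| <= c.
  have : \forall x \near y, U x /\
      forall i : 'I_n, `|delta_mx 0 i - 'd f x (delta_mx 0 i)| <= c.
    apply: filterI (open_nbhs_nbhs (conj oU Uy)) _.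
    apply: (@filter_forall _ _ _ (nbhs y)) => i.
    have := cf (delta_mx 0 i) y Uy; rewrite /prop_for /continuous_at.
    by move=> /cvgrPdist_le/(_ c c0); apply: filterS => x; rewrite {1}dfy.
  by move=> /nbhs_ballP[e e0 eP]; exists e => // x /eP.
pose u (x : 'rV[R]_n) := x - f x.
have du x : U x -> is_diff x u (fun v => v - 'd f x v).
  move=> /df/differentiableP dfx.
  rewrite (_ : u = id - f)//; exact: is_diffB.
have dub x v : ball y e x -> `|v - 'd f x v| <= 2^-1 * `|v|.
  move=> /eU[Ux ux]; have [_ due] := du _ Ux.
  have duE w : 'd u x w = w - 'd f x w by exact: (congr1 (@^~ w) due).
  have uc i : `|'d u x (delta_mx 0 i)| <= c by rewrite (duE (delta_mx 0 i)).
  rewrite -(duE v) (le_trans (norm_linear_rV_le uc v))//.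
  by rewrite ler_wpM2r.
have ulip a b : ball y e a -> ball y e b -> `|u b - u a| <= 2^-1 * `|b - a|.
  apply: (@mean_value_bound _ _ u (ball y e)) => //.
  - move=> {}a {}b t; rewrite -ball_normE /= => ya yb /andP[t0 t1].
    have -> : y - (t *: (b - a) + a) = (1 - t) *: (y - a) + t *: (y - b).
      by apply/rowP => i; rewrite !mxE; ring.
    rewrite (le_lt_trans (ler_normD _ _))// !normrZ !ger0_norm ?subr_ge0//.
    have ht1 : 0 <= 1 - t by rewrite subr_ge0.
    have := ler_wpM2l ht1 (ltW ya).
    (* Strictness comes from the second term if [t > 0], and from the first if [t = 0]. *)
    have [->|tn0] := eqVneq t 0; first by rewrite subr0 !mul1r mul0r; lra.
    have : t * `|y - b| < t * e by rewrite ltr_pM2l// lt0r tn0.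
    lra.
  - by move=> x /eU[/du[]].
  - move=> x v xe; have [/du[_ due] _] := eU _ xe.
    by rewrite (congr1 (@^~ v) due); exact: dub.
have finj a b : ball y e a -> ball y e b -> `|b - a| <= 2 * `|f b - f a|.
  move=> ya yb; have := ulip _ _ ya yb.
  have : `|b - a| <= `|u b - u a| + `|f b - f a|.
    by rewrite (le_trans _ (ler_normD _ _))// /u addrACA subrK -opprD subrK.
  lra.
(* The closed ball of radius [d], on which the fixed point theorem is applied, stays inside the open
   ball of radius [e]. *)
pose d := e / 2.
have d0 : 0 < d by rewrite divr_gt0.
have de x : `|y - x| <= d -> ball y e x.
  by rewrite -ball_normE /= => /le_lt_trans; apply; rewrite /d; lra.
have fc x : ball y d x -> {for x, continuous f}.
  rewrite -ball_normE => /ltW/de/eU[Ux _].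
  exact/differentiable_continuous/df.
(* For [z] within [d / 2] of [f y], the map [x |-> z + u x] moves the closed [d]-ball into itself,
   as [u] is 1/2-Lipschitz. *)
exists (ball y d `&` f @^-1` (ball (f y) (d / 2))), (ball (f y) (d / 2)).
split; last first.
  move=> z; rewrite -ball_normE /= => fyz.
  pose K := closed_ball_ Num.norm y d.
  pose T x := z + u x.
  have TK : {homo T : x / K x}.
    move=> x Kx; rewrite /K /closed_ball_ /=.
    have -> : y - T x = (f y - z) - (u x - u y).
      by apply/rowP => i; rewrite /T /u !mxE; ring.
    rewrite (le_trans (ler_normB _ _))//.
    have yy : ball y e y by exact: ballxx.
    have := ulip _ _ yy (de _ Kx); move: Kx; rewrite /K /closed_ball_ /=.
    by rewrite (distrC x y); lra.
  have [|||x Kx xE] := @banach_fixed_point R 'rV[R]_n K (mkfun_fun TK).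
  - exists (NngNum (ltW (divr_gt0 ltr01 (ltr0Sn R 1)))); split => /=; first lra.
    move=> [a b] [/= Ka Kb]; rewrite div1r.
    rewrite /mkfun /T opprD addrACA subrr add0r ulip//; exact: de.
  - exact: closed_closed_ball_.
  - by exists y; rewrite /K /closed_ball_ /= subrr normr0 ltW.
  have fxz : f x = z.
    have xE' : x = z + (x - f x) by exact: xE.
    apply/esym/eqP; rewrite -subr_eq0; apply/eqP.
    have -> : z - f x = z + (x - f x) - x.
      by apply/rowP => i; rewrite !mxE; ring.
    by rewrite -xE' subrr.
  have yy : ball y e y by exact: ballxx.
  (* The fixed point is so far only in the closed ball; [finj] gives
     [|y - x| <= 2 |f y - z| < d]. *)
  exists x => //; split; last by rewrite /= fxz.
  have := finj _ _ yy (de _ Kx); rewrite fxz distrC (distrC z).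
  by move: fyz; lra.
have dball x : ball y d x -> ball y e x.
  by move=> yx; apply: de; move: yx; rewrite -ball_normE => /ltW.
split.
- by split; [apply: open_setI_preimage => //|]; exact: ball_open.
- split; first by split; apply: ballxx => //; rewrite divr_gt0.
  by move=> x [/dball/eU[]].
- move=> x v [/dball /(dub _ v) xv _].
  have : `|v| <= `|v - 'd f x v| + `|'d f x v|.
    by rewrite (le_trans _ (ler_normD _ _))// subrK.
  lra.
- by move=> a b [/dball ya _] [/dball yb _]; exact: finj.
- by move=> x [].
Qed.

Lemma mul_rV_jacobian m n (f : 'rV[R]_m -> 'rV[R]_n) x v :
  v *m 'J f x = 'd f x v.
Proof. by rewrite /jacobian mul_rV_lin1. Qed.

(** The estimates on [U'] make [f] injective with 2-Lipschitz inverse [g] and invertible Jacobian.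
    The Lipschitz bound turns the error term of [f] at [g z] into one for [g] at [z]. *)
Lemma inverse_function_id n (f : 'rV[R]_n -> 'rV[R]_n) (U : set 'rV[R]_n) y :
  open U -> U y -> class_C 1 U f -> (forall v, 'd f y v = v) ->
  exists (U' V' : set 'rV[R]_n) g,
    [/\ U' y, U' `<=` U & diffeo 1 U' V' f g].
Proof.
move=> oU Uy fC1 dfy.
have [U' [V' [[[oU' oV'] [U'y sU'] dfinj finj fV'] fsurj]]] :=
  local_inverse_id oU Uy fC1 dfy.
have [df cf] := class_C_sub sU' fC1.
pose g z := xget y [set x | U' x /\ f x = z].
have gP z : V' z -> U' (g z) /\ f (g z) = z.
  move=> /fsurj[x U'x fx].
  by apply: (@xgetPex _ y [set x | U' x /\ f x = z]); exists x.
have gf x : U' x -> g (f x) = x.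
  move=> U'x; have [U'g fg] := gP _ (fV' _ U'x).
  apply/eqP; rewrite -subr_eq0 -normr_le0.
  by rewrite (le_trans (finj _ _ U'x U'g))// fg subrr normr0 mulr0.
have glip a b : V' a -> V' b -> `|g b - g a| <= 2 * `|b - a|.
  move=> /gP[Ua fa] /gP[Ub fb]; have := finj _ _ Ua Ub.
  by rewrite fa fb.
have Junit x : U' x -> 'J f x \in unitmx.
  move=> U'x; rewrite -row_free_unit; apply: inj_row_free => v.
  rewrite mul_rV_jacobian => v0; apply/eqP; rewrite -normr_le0.
  by rewrite (le_trans (dfinj _ _ U'x))// v0 normr0 mulr0.
pose dg z := mulmxr (invmx ('J f (g z))) : 'rV[R]_n -> 'rV[R]_n.
have dgP z : V' z -> is_diff z g (dg z).
  move=> V'z; have [U'x fx] := gP _ V'z.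
  have Lc := @linear_rV_continuous R n _ (mulmxr (invmx ('J f (g z)))).
  apply: is_diff_near_bound => // e e0.
  have [C C0 LC] := linear_lipschitz Lc.
  (* [C] absorbs the norm of the inverse Jacobian, and 2 the Lipschitz constant of [g]. *)
  have e'0 : 0 < e / (2 * C) by rewrite divr_gt0 ?mulr_gt0.
  have /nbhs_ballP[r /= r0 rP] := diff_near_bound (df _ U'x) e'0.
  have /nbhs_ballP[s /= s0 sP] : nbhs z V' by exact: open_nbhs_nbhs.
  (* Radius [s] keeps [h + z] in [V']; radius [r / 2] keeps the increment of [g] below [r]. *)
  apply/nbhs_ballP; exists (Num.min s (r / 2)) => /=.
    by rewrite lt_min s0 divr_gt0.
  move=> h; rewrite -ball_normE /= sub0r normrN lt_min => /andP[hs hr].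
  have V'h : V' (h + z).
    by apply: sP; rewrite -ball_normE /= opprD addrCA subrr addr0 normrN.
  pose k := g (h + z) - g z.
  have kh : `|k| <= 2 * `|h|.
    by have := glip _ _ V'z V'h; rewrite addrK.
  have : ball 0 r k by rewrite -ball_normE /= sub0r normrN; lra.
  move=> /rP; rewrite /= /k subrK -/k (gP _ V'h).2 fx addrK => hk.
  have -> : k - h *m invmx ('J f (g z)) =
      - ((h - 'd f (g z) k) *m invmx ('J f (g z))).
    by rewrite mulmxBl -mul_rV_jacobian mulmxK ?Junit// opprB.
  rewrite normrN (le_trans (LC _))//.
  rewrite (le_trans (ler_wpM2l (ltW C0) hk))//.
  have -> : C * (e / (2 * C) * `|k|) = e / 2 * `|k|.
    by field; rewrite gt_eqF.
  have : e / 2 * `|k| <= e / 2 * (2 * `|h|).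
    by rewrite ler_wpM2l// divr_ge0// ltW.
  lra.
exists U', V', g; split => //; split => //.
- split; first exact: class_C_sub fC1.
  apply: (class_C1_is_diff oV' dgP) => v z V'z.
  have [U'x fx] := gP _ V'z.
  have [/differentiable_continuous gc _] := dgP _ V'z.
  suff : dg z' v @[z' --> z] --> dg z v by [].
  apply/(@cvgrPdist_le _ _ _ (nbhs z)) => e e0.
  (* With [w = dg z' v - dg z v], one has [|w| <= 2 |Df(g z') w|] and
     [Df(g z') w = v - Df(g z')(dg z v)], which tends to 0 as [z'] tends to [z]. *)
  have := continuous_comp gc (cf (dg z v) _ U'x).
  have dfdg z' : V' z' -> 'd f (g z') (dg z' v) = v.
    move=> V'z'; rewrite -mul_rV_jacobian /dg /= mulmxKV//.
    exact/Junit/(gP _ V'z').1.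
  rewrite /prop_for /continuous_at /=; move=> /cvgrPdist_le.
  have e20 : 0 < e / 2 by rewrite divr_gt0.
  move=> /(_ _ e20) he; near=> z'.
  have V'z' : V' z' by near: z'; exact: open_nbhs_nbhs.
  have hz' : `|v - 'd f (g z') (dg z v)| <= e / 2.
    by rewrite -{1}(dfdg _ V'z); near: z'.
  have dB : 'd f (g z') (dg z' v - dg z v) = v - 'd f (g z') (dg z v).
    by rewrite linearB; congr (_ - _); exact: dfdg.
  rewrite distrC (le_trans (dfinj _ _ (gP _ V'z').1))// dB; lra.
- by move=> x U'x; split; [exact: fV'|exact: gf].
Unshelve. all: by end_near. Qed.

(** Composing [f] with the inverse of its Jacobian at [y] reduces to the case of identity
    differential. *)
Theorem inverse_function n (f : 'rV[R]_n -> 'rV[R]_n) (U : set 'rV[R]_n) y :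
  open U -> U y -> class_C 1 U f -> 'J f y \in unitmx ->
  exists (U' V' : set 'rV[R]_n) g,
    [/\ U' y, U' `<=` U & diffeo 1 U' V' f g].
Proof.
move=> oU Uy fC1 Ju; set A := 'J f y.
pose L : {linear 'rV[R]_n -> 'rV[R]_n} := mulmxr (invmx A).
have LC1 (W : set 'rV[R]_n) : class_C 1 W L by exact: class_C1_linear_rV.
have [//|||U' [V' [g [U'y sU' [[oU' oV'] [_ gC1] fg gf]]]]] :=
  @inverse_function_id n (L \o f) U y oU.
- exact: (class_C1_comp (U' := setT)).
- move=> v; have dfy := differentiableP (fC1.1 _ Uy).
  have [_ dE] := is_diff_comp dfy (is_diff_linear_rV L (f y)).
  by rewrite (congr1 (@^~ v) dE) /= -mul_rV_jacobian mulmxK.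
have oV : open (L @^-1` V').
  by apply: open_comp => // z _; exact: linear_rV_continuous.
exists U', (L @^-1` V'), (g \o L); split => //; split => //.
- split; first exact: class_C_sub fC1.
  exact: (class_C1_comp (U' := V')).
- move=> z /gf[U'z Lz]; split => //.
  by have := congr1 (mulmx^~ A) Lz; rewrite /= !mulmxKV.
Qed.

End inverse_function.

(** * Tangent spaces and retractions *)

Section tangent_spaces.
Context {R : realType} {n : nat}.
Implicit Types (S B M U V : set 'rV[R]_n) (v w y : 'rV[R]_n).

(** Serves to differentiate identities that hold only near a point. *)
Lemma near_eq_is_diff (X Y : normedModType R) (f g df dg : X -> Y) (x : X) :
  (\forall z \near x, f z = g z) -> is_diff x f df -> is_diff x g dg ->
  df =1 dg.
Proof.
move=> fg [df1 dfE] [dg1 dgE] v.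
rewrite -(congr1 (@^~ v) dfE) -(congr1 (@^~ v) dgE).
have := near_eq_derive v fg.
by rewrite (deriveE v df1) (deriveE v dg1).
Qed.

Lemma tangent_spaceP M y v : tangent_space M y v ->
  exists (c : R -> 'rV[R]_n) (dc : R -> 'rV[R]_n),
    [/\ \forall t \near (0 : R), M (c t), c 0 = y, is_diff (0 : R) c dc &
        dc 1 = v].
Proof.
move=> [e [c [e0 [dc _] cM c0 cv]]].
have d0 : differentiable c 0 by apply: dc; rewrite /= in_itv /= oppr_lt0 e0.
exists c, ('d c (0 : R)); split => //.
- near=> t; apply: cM; rewrite -ltr_norml.
  by near: t; exact: (@nbhs0_lt R R).
- by rewrite -derive1E'.
Unshelve. all: by end_near. Qed.

(** Produces tangent vectors from images of straight lines; [f] will be an inverse chart or the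
    retraction. *)
Lemma tangent_space_affine M U y a w v (f : 'rV[R]_n -> 'rV[R]_n) :
  open U -> U y -> class_C 1 U f ->
  (\forall t \near (0 : R), M (f (t *: w + y))) ->
  f y = a -> 'd f y w = v -> tangent_space M a v.
Proof.
move=> oU Uy fC1 fM <- <-.
pose p (t : R) := t *: w + y.
have dp (t : R) : is_diff t p ( *:%R ^~ w) by exact: is_diff_affine.
have p0 : p 0 = y by rewrite /p scale0r add0r.
have pU : \forall t \near (0 : R), U (p t).
  have pc : {for (0 : R), continuous p}.
    by apply: differentiable_continuous; case: (dp 0).
  by apply: pc; rewrite p0; exact: open_nbhs_nbhs.
have /nbhs_ballP[e /= e0 eP] : nbhs (0 : R) [set t | U (p t) /\ M (f (p t))].
  exact: filterI pU fM.
have eP' t : - e < t < e -> U (p t) /\ M (f (p t)).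
  by move=> te; apply: eP; rewrite -ball_normE /= sub0r normrN ltr_norml.
exists e, (f \o p); split => //.
- apply: (class_C1_comp (U' := U)) => //.
  + exact: class_C1_affine.
  + by move=> t; rewrite /= in_itv /= => /eP'[].
- by move=> t /eP'[].
- by rewrite /= p0.
- have dfy : is_diff (p 0) f ('d f (p 0)).
    by apply/differentiableP/fC1.1; rewrite p0.
  have [dfp dE] := is_diff_comp (dp 0) dfy.
  by rewrite derive1E'// (congr1 (@^~ 1) dE) /= scale1r p0.
Qed.

Lemma diffeo_diffK U V (phi psi : 'rV[R]_n -> 'rV[R]_n) y v :
  diffeo 1 U V phi psi -> U y -> 'd psi (phi y) ('d phi y v) = v.
Proof.
move=> [[oU oV] [dphi dpsi] phiK _] Uy.
have dphiy := differentiableP (dphi.1 _ Uy).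
have dpsiy := differentiableP (dpsi.1 _ (phiK _ Uy).1).
apply: (near_eq_is_diff _ (is_diff_comp dphiy dpsiy) (is_diff_id y)).
near=> z; have Uz : U z by near: z; exact: open_nbhs_nbhs.
exact: (phiK _ Uz).2.
Unshelve. all: by end_near. Qed.

(** The last coordinates of a curve in [M] vanish in the chart, hence so do their derivatives.
    Conversely, the line through [phi y] in direction ['d phi y v] stays in the slice, and [psi]
    carries it back to [M]. *)
Lemma tangent_space_slice k M U V (phi psi : 'rV[R]_n -> 'rV[R]_n) y v :
  diffeo 1 U V phi psi -> U y -> M y ->
  (forall x, U x -> (M x <-> forall i : 'I_n, (k <= i)%N -> phi x 0 i = 0)) ->
  tangent_space M y v <->
  forall i : 'I_n, (k <= i)%N -> 'd phi y v 0 i = 0.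
Proof.
move=> diff_phi Uy My MU.
have [[oU oV] [dphi dpsi] phiK psiK] := diff_phi.
have dphiy := differentiableP (dphi.1 _ Uy).
split=> [/tangent_spaceP[c [dc [cM c0 cd dc1]]] i ki|vT].
  rewrite -c0 in dphiy.
  have dphic := is_diff_comp cd dphiy.
  have dphici := is_diff_comp dphic (is_diff_coord (phi (c 0)) 0 i).
  have cc : {for (0 : R), continuous c}.
    by apply: differentiable_continuous; case: cd.
  have := near_eq_is_diff _ dphici (is_diff_cst 0 (0 : R)).
  rewrite -dc1 -c0; apply; near=> t => /=.
  have Uct : U (c t).
    by near: t; apply: cc; rewrite c0; exact: open_nbhs_nbhs.
  by apply: (MU _ Uct).1 => //; near: t.
have Vy := (phiK _ Uy).1.
apply: (tangent_space_affine oV Vy dpsi _ (phiK _ Uy).2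
  (diffeo_diffK v diff_phi Uy)).
pose p (t : R) := t *: 'd phi y v + phi y.
have pc : {for (0 : R), continuous p}.
  apply: differentiable_continuous.
  by case: (is_diff_affine (phi y) ('d phi y v) (0 : R)).
near=> t.
have Vt : V (p t).
  near: t; apply: pc; rewrite /p scale0r add0r; exact: open_nbhs_nbhs.
apply: (MU _ (psiK _ Vt).1).2 => i ki.
by rewrite (psiK _ Vt).2 /p !mxE vT// mulr0 add0r (MU _ Uy).1.
Unshelve. all: by end_near. Qed.

(** The curve [r (t *: v + y)] runs in [S]. *)
Lemma retraction_diff_tangent S B r y v : open B -> S `<=` B ->
  C1_retraction S B r -> S y -> tangent_space S y ('d r y v).
Proof.
move=> oB sSB [rC1 rS rK] Sy; have By := sSB _ Sy.
apply: (tangent_space_affine oB By rC1 _ (rK _ Sy) (erefl _)).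
pose p (t : R) := t *: v + y.
have pc : {for (0 : R), continuous p}.
  apply: differentiable_continuous.
  by case: (is_diff_affine y v (0 : R)).
near=> t; apply: rS.
by near: t; apply: pc; rewrite /p scale0r add0r; exact: open_nbhs_nbhs.
Unshelve. all: by end_near. Qed.

(** Differentiates [r (c t) = c t] along a curve [c] in [S]. *)
Lemma retraction_diff_id S B r y w : S `<=` B ->
  C1_retraction S B r -> tangent_space S y w -> S y -> 'd r y w = w.
Proof.
move=> sSB [rC1 rS rK] /tangent_spaceP[c [dc [cS c0 cd dc1]]] Sy.
have dr := differentiableP (rC1.1 _ (sSB _ Sy)); rewrite -c0 in dr.
have := near_eq_is_diff _ (is_diff_comp cd dr) cd.
move=> /(_ _ 1) /=; rewrite c0 dc1; apply.
by near=> t => /=; apply: rK; near: t.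
Unshelve. all: by end_near. Qed.

(** Here [r] is constant along curves in the fiber. *)
Lemma retraction_diff_fiber S B r y v : S `<=` B ->
  C1_retraction S B r -> S y ->
  tangent_space (preimage_in B r y) y v -> 'd r y v = 0.
Proof.
move=> sSB [rC1 rS rK] Sy /tangent_spaceP[c [dc [cM c0 cd dc1]]].
have dr := differentiableP (rC1.1 _ (sSB _ Sy)); rewrite -c0 in dr.
have := near_eq_is_diff _ (is_diff_comp cd dr) (is_diff_cst y (0 : R)).
move=> /(_ _ 1) /=; rewrite c0 dc1; apply.
by apply: filterS cM => t [].
Qed.

End tangent_spaces.

(** * Orthogonal projectors *)

Section projectors.
Context {R : realType} {n : nat}.
Implicit Types (T : set 'rV[R]_n) (u v w : 'rV[R]_n) (Q : 'M[R]_n).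

Lemma dotpE u v : dotp u v = (u *m v^T) 0 0.
Proof. by rewrite mxE; apply: eq_bigr => i _; rewrite mxE. Qed.

Lemma dotpBl u v w : dotp (u - v) w = dotp u w - dotp v w.
Proof. by rewrite !dotpE mulmxBl !mxE. Qed.

Lemma dotp_eq0 v : dotp v v = 0 -> v = 0.
Proof.
move=> /eqP; rewrite psumr_eq0 => [/allP v0|i _]; last exact: sqr_ge0.
apply/rowP => i; rewrite mxE; apply/eqP; rewrite -sqrf_eq0 expr2.
by apply: v0; rewrite mem_index_enum.
Qed.

(** If [v] is orthogonal to [T], then so is [v *m Q], being a difference of two such vectors; lying
    in [T], it is orthogonal to itself. *)
Lemma orth_projector_ker T Q v :
  is_orth_projector T Q -> v *m Q = 0 <-> orth_compl T v.
Proof.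
move=> TQ; split => [vQ0|Tv]; have [TvQ Nv] := TQ v.
  by move: Nv; rewrite vQ0 subr0.
apply: dotp_eq0; have := Nv _ TvQ; rewrite dotpBl Tv// sub0r => /eqP.
by rewrite oppr_eq0 => /eqP.
Qed.

(** The difference of the two projections of [v] is orthogonal to [T], so to both projections, hence
    to itself. *)
Lemma orth_projector_unique T Q Q' :
  is_orth_projector T Q -> is_orth_projector T Q' -> Q = Q'.
Proof.
move=> TQ TQ'; apply/row_matrixP => i; rewrite !rowE; set v := delta_mx 0 i.
have [TvQ Nv] := TQ v; have [TvQ' Nv'] := TQ' v.
apply/eqP; rewrite -subr_eq0; apply/eqP.
have N w : T w -> dotp (v *m Q - v *m Q') w = 0.
  move=> Tw; have -> : v *m Q - v *m Q' = (v - v *m Q') - (v - v *m Q).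
    by rewrite opprB [RHS]addrC subrKA.
  by rewrite dotpBl Nv'// Nv// subrr.
apply: dotp_eq0; rewrite dotpE linearB mulmxBr mxE -dotpE N// add0r.
by rewrite mxE -dotpE N// oppr0.
Qed.

(** The hypotheses make [T] the row space of [D]. With a row basis [C], the orthogonal projector is
    given by the Gram matrix formula [C^T (C C^T)^-1 C]. *)
Lemma orth_projector_exists T (D : 'M[R]_n) :
  (forall v, T (v *m D)) -> (forall w, T w -> w *m D = w) ->
  exists Q, is_orth_projector T Q.
Proof.
move=> TD DT; pose C := row_base D.
have Cfree : row_free C by exact: row_base_free.
have Gu : C *m C^T \in unitmx.
  rewrite -row_free_unit; apply: inj_row_free => v vG.
  have /dotp_eq0 vC0 : dotp (v *m C) (v *m C) = 0.
    by rewrite dotpE trmx_mul mulmxA -(mulmxA v) vG mul0mx mxE.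
  by apply: (row_free_inj Cfree); rewrite vC0 mul0mx.
pose Q := C^T *m invmx (C *m C^T) *m C.
exists Q => v; split.
  have /submxP[u ->] : (v *m Q <= D)%MS.
    by rewrite -(eq_row_base D) mulmxA submxMl.
  exact: TD.
move=> w /DT Dw.
have /submxP[u wE] : (w <= C)%MS by rewrite eq_row_base -Dw submxMl.
have QC : Q *m C^T = C^T by rewrite -mulmxA mulmxKV.
by rewrite dotpE wE trmx_mul mulmxA mulmxBl -mulmxA QC subrr mul0mx mxE.
Qed.

End projectors.

(** * Fibers of a retraction *)

Section fibers.
Context {R : realType} {n : nat}.
Implicit Types (S B M U V : set 'rV[R]_n) (v w y : 'rV[R]_n).

(** Reversal is needed because slice charts want the vanishing coordinates last, whereas [phi] puts
    the coordinates along [S] first. *)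
Definition rev_select_mx (p : pred nat) : 'M[R]_n :=
  \matrix_(i, j) (p i && (i == rev_ord j))%:R.

Lemma mul_rev_select_mx p v j :
  (v *m rev_select_mx p) 0 j = if p (rev_ord j) then v 0 (rev_ord j) else 0.
Proof.
rewrite mxE (bigD1 (rev_ord j)) //= mxE eqxx andbT big1 => [|i /negPf ij].
  by rewrite addr0; case: ifP; rewrite ?mulr1 ?mulr0.
by rewrite mxE ij andbF mulr0.
Qed.

(* Slice chart of the fiber: the coordinates of [r x] along [S] are put last,
   preceded by the linear coordinates transversal to [S] at [y]. *)
Lemma retraction_fiber_chart k S B r y :
  open B -> S `<=` B -> embedded_submanifold 2 k S -> C1_retraction S B r ->
  S y ->
  exists U V (Phi Psi : 'rV[R]_n -> 'rV[R]_n),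
    [/\ U y, diffeo 1 U V Phi Psi,
        forall x, U x -> (preimage_in B r y x <->
          forall i : 'I_n, (n - k <= i)%N -> Phi x 0 i = 0) &
        forall v, 'd r y v = 0 ->
          forall i : 'I_n, (n - k <= i)%N -> 'd Phi y v 0 i = 0].
Proof.
move=> oB sSB [_ Schart] hr Sy; have [rC1 rS rK] := hr.
have By := sSB _ Sy.
have [U [V [phi [psi [Uy [oUV [phiC2 psiC2] phiK psiK] SU]]]]] := Schart _ Sy.
have phiC1 := class_CSW phiC2; have psiC1 := class_CSW psiC2.
have diff_phi : diffeo 1 U V phi psi by split.
have [oU oV] := oUV.
pose P1 := rev_select_mx (fun i => i < k)%N.
(* The transversal coordinates are linearized at [y], so only [r x], and not [x], has to lie in the
   chart domain [U]. *)
pose P2 := 'J phi y *m rev_select_mx (fun i => k <= i)%N.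
pose L1 : {linear 'rV[R]_n -> 'rV[R]_n} := mulmxr P1.
pose L2 : {linear 'rV[R]_n -> 'rV[R]_n} := mulmxr P2.
(* The constant normalizes [Phi y] to 0. *)
pose Phi := (L1 \o (phi \o r)) + L2 + cst (- (L1 (phi y) + L2 y)).
pose W := B `&` r @^-1` U.
have oW : open W.
  apply: (open_setI_preimage oB oU) => x Bx.
  exact/differentiable_continuous/rC1.1.
have Wy : W y by split => //; rewrite /= rK.
have PhiC1 : class_C 1 W Phi.
  have rW : class_C 1 W r by apply: class_C_sub rC1 => x [].
  have c1 : class_C 1 W (phi \o r).
    by apply: (class_C1_comp oW rW phiC1) => x [].
  have c2 : class_C 1 W (L1 \o (phi \o r)).
    exact: (class_C1_comp oW c1 (class_C1_linear_rV setT L1)).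
  exact: (class_C1D oW (class_C1D oW c2 (class_C1_linear_rV W L2))
    (class_C1_cst _ _)).
pose D v : 'rV[R]_n := 'd phi y ('d r y v) *m P1 + v *m P2.
have dPhi v : 'd Phi y v = D v.
  have dr := differentiableP (rC1.1 _ By).
  have dphi : is_diff (r y) phi ('d phi y).
    by rewrite (rK _ Sy); exact/differentiableP/phiC1.1.
  have d1 := is_diff_comp (is_diff_comp dr dphi)
    (is_diff_linear_rV L1 ((phi \o r) y)).
  have d2 := is_diffD (is_diffD d1 (is_diff_linear_rV L2 y))
    (is_diff_cst (- (L1 (phi y) + L2 y)) y).
  have [_ dE] := d2.
  rewrite -[RHS]addr0; exact: (congr1 (@^~ v) dE).
have rev_lt (j : 'I_n) : (n - k <= j)%N = (rev_ord j < k)%N.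
  by rewrite /=; have := ltn_ord j; lia.
have J2 v j : (v *m P2) 0 j =
    if (k <= rev_ord j)%N then 'd phi y v 0 (rev_ord j) else 0.
  by rewrite mulmxA mul_rV_jacobian mul_rev_select_mx.
have D_last v (j : 'I_n) : (n - k <= j)%N ->
    D v 0 j = 'd phi y ('d r y v) 0 (rev_ord j).
  rewrite rev_lt => jk; rewrite mxE J2 mul_rev_select_mx jk.
  by rewrite leqNgt jk addr0.
(* If [D v = 0], the transversal part makes [v] tangent to [S], so ['d r y v = v]; the other part
   then kills the remaining coordinates of ['d phi y v]. *)
have Junit : 'J Phi y \in unitmx.
  rewrite -row_free_unit; apply: inj_row_free => v.
  rewrite mul_rV_jacobian => /(etrans (esym (dPhi v))) v0.
  have v1 (i : 'I_n) : (k <= i)%N -> 'd phi y v 0 i = 0.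
    move=> ki; have := congr1 (fun u : 'rV[R]_n => u 0 (rev_ord i)) v0.
    rewrite mxE J2 mul_rev_select_mx rev_ordK ki ltnNge ki add0r => ->.
    by rewrite mxE.
  have Tv : tangent_space S y v.
    by apply/(tangent_space_slice v diff_phi Uy Sy SU).
  have rv := retraction_diff_id sSB hr Tv Sy.
  suff phiv0 : 'd phi y v = 0.
    apply: etrans (esym (diffeo_diffK v diff_phi Uy)) _.
    exact: etrans (congr1 _ phiv0) (linear0 _).
  apply/rowP => i; rewrite [RHS]mxE.
  have [ki|ik] := leqP k i; first exact: v1.
  have ik' : (n - k <= rev_ord i)%N by rewrite rev_lt rev_ordK.
  apply: etrans (congr1 (fun u => 'd phi y u 0 i) (esym rv)) _.
  by have := D_last v _ ik'; rewrite rev_ordK v0 mxE => /esym.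
have [U' [V' [Psi [U'y U'W dPhiPsi]]]] := inverse_function oW Wy PhiC1 Junit.
exists U', V', Phi, Psi; split => //; last first.
  move=> v rv0 i ki.
  apply: etrans (congr1 (fun u : 'rV[R]_n => u 0 i) (dPhi v)) _.
  rewrite D_last//; have -> : 'd phi y ('d r y v) = 0.
    exact: etrans (congr1 _ rv0) (linear0 _).
  by rewrite mxE.
move=> x /U'W[Bx Urx].
have Phi_last (j : 'I_n) : (n - k <= j)%N ->
    Phi x 0 j = phi (r x) 0 (rev_ord j) - phi y 0 (rev_ord j).
  rewrite rev_lt => jk.
  have -> : Phi x = phi (r x) *m P1 + x *m P2 - (phi y *m P1 + y *m P2) by [].
  have coordD (a b : 'rV[R]_n) : (a + b) 0 j = a 0 j + b 0 j by rewrite mxE.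
  have coordN (a : 'rV[R]_n) : (- a) 0 j = - a 0 j by rewrite mxE.
  rewrite !(coordD, coordN) !J2 !mul_rev_select_mx jk leqNgt jk.
  by rewrite !addr0.
split=> [[_ rxy] j jk|Phi0].
  by rewrite Phi_last// rxy subrr.
split=> //; rewrite -(phiK _ Urx).2 -(phiK _ Uy).2; congr psi.
(* The coordinates from [k] on vanish since [r x] and [y] lie in [S]; the first [k] agree by the
   vanishing of [Phi]. *)
apply/rowP => i; have [ki|ik] := leqP k i.
  by rewrite (SU _ Urx).1 ?(SU _ Uy).1//; exact: rS.
apply/eqP; rewrite -subr_eq0; apply/eqP.
have := Phi_last (rev_ord i).
by rewrite rev_ordK Phi0 ?rev_lt ?rev_ordK// => <-.
Qed.

(** One inclusion differentiates [r] along the fiber; the other reads the kernel of ['d r y] in the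
    slice chart of the fiber. *)
Lemma retraction_fiber_tangent k S B r y v :
  open B -> S `<=` B -> embedded_submanifold 2 k S -> C1_retraction S B r ->
  S y -> tangent_space (preimage_in B r y) y v <-> v *m 'J r y = 0.
Proof.
move=> oB sSB Sk hr Sy; rewrite mul_rV_jacobian; split.
  exact: (retraction_diff_fiber sSB hr Sy).
have [U [V [Phi [Psi [Uy dPhi PhiM dPhi0]]]]] :=
  retraction_fiber_chart oB sSB Sk hr Sy.
move=> /dPhi0 Phiv; apply/(tangent_space_slice v dPhi Uy _ PhiM) => //.
by split; [exact: sSB|have [_ _] := hr; apply].
Qed.

(** The single chart at [y] serves all points of the fiber in [U], with dimension [n - k]. *)
Lemma retraction_fiber_manifold k S B r y :
  open B -> S `<=` B -> embedded_submanifold 2 k S -> C1_retraction S B r ->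
  S y -> locally_C1_manifold (preimage_in B r y) y.
Proof.
move=> oB sSB Sk hr Sy.
have [U [V [Phi [Psi [Uy dPhi PhiM _]]]]] :=
  retraction_fiber_chart oB sSB Sk hr Sy.
have [[oU _] _ _ _] := dPhi.
exists U, (n - k)%N; split => //; split; first exact: leq_subr.
move=> y' [_ Uy']; exists U, V, Phi, Psi; split => // x Ux.
by split=> [[/(PhiM _ Ux)]|/(PhiM _ Ux)].
Qed.

End fibers.

(** * Orthogonal fibers and the closest point property *)

Theorem theorem3p7 (R : realType) (n k : nat) (S B : set 'rV[R]_n)
    (r : 'rV[R]_n -> 'rV[R]_n)
    (hS : surface_with_band k S B) (hr : C1_retraction S B r) :
  (forall y, S y -> locally_C1_manifold (preimage_in B r y) y) /\
  ((forall y, S y -> 'J r y = orth_projector (tangent_space S y)) <->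
   (forall y, S y -> tangent_space (preimage_in B r y) y = normal_space S y)).
Proof.
have [Sk _ [oB sSB _]] := hS.
have TJ y v : S y -> tangent_space S y (v *m 'J r y).
  by move=> Sy; rewrite mul_rV_jacobian; exact: retraction_diff_tangent hr Sy.
have JT y w : S y -> tangent_space S y w -> w *m 'J r y = w.
  by move=> Sy Tw; rewrite mul_rV_jacobian; exact: retraction_diff_id hr Tw Sy.
(* The Jacobian is a possibly oblique projector onto the tangent space, so the orthogonal one exists
   and [orth_projector] is not the dummy value. *)
have projP y : S y -> is_orth_projector (tangent_space S y)
    (orth_projector (tangent_space S y)).
  move=> Sy; apply: (@xgetPex _ 0 [set Q | is_orth_projector _ Q]).
  exact: (orth_projector_exists (fun v => TJ y v Sy) (fun w => JT y w Sy)).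
have fiberP y v : S y ->
    tangent_space (preimage_in B r y) y v <-> v *m 'J r y = 0.
  exact: retraction_fiber_tangent Sk hr.
split=> [y Sy|]; first exact: retraction_fiber_manifold Sk hr Sy.
split=> [JP y Sy|TN y Sy].
  apply/seteqP; split => v.
    move=> /(fiberP _ _ Sy); rewrite JP//.
    by move=> /(orth_projector_ker v (projP _ Sy)).
  move=> Nv; apply/(fiberP _ _ Sy); rewrite JP//.
  by apply/(orth_projector_ker v (projP _ Sy)).
(* By idempotence [v - v *m 'J r y] lies in the kernel of the Jacobian, that is in the tangent space
   of the fiber, which is normal to [S] by assumption. *)
apply: orth_projector_unique (projP _ Sy) => v; split; first exact: TJ.
have : tangent_space (preimage_in B r y) y (v - v *m 'J r y).
  by apply/(fiberP _ _ Sy); rewrite mulmxBl (JT _ _ Sy (TJ _ v Sy)) subrr.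
by rewrite TN.
Qed.
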